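(* Let $A \in \mathbb{C}_{n,m}$ and $D,E \in \mathbb{C}_{m,n}$. The following statements are equivalent. (i) The $(D, E)$-inverse of $A$ exists. (ii) $\mathrm{rk}(D)=\mathrm{rk}(E)=\mathrm{rk}(EAD)$. Furthermore, in this case $A^{\parallel (D, E)}=D(EAD)^\dagger E$.
   Context: $\mathbb{C}_{m,n}$ is the set of $m\times n$ complex matrices ($m,n\in\mathbb{N}$). For a matrix $M\in\mathbb{C}_{p,q}$, $\mathcal{R}(M)$ is its column space, $\mathcal{N}(M)=\{\mathbf{x}\in\mathbb{C}^q: M\mathbf{x}=\mathbf{0}\}$ its null space, $\mathrm{rk}(M)$ its rank, and $M^\dagger$ its Moore-Penrose inverse. For $A \in \mathbb{C}_{n,m}$ and $D,E \in \mathbb{C}_{m,n}$, $A$ is $(D,E)$-invertible if there exists $X\in\mathbb{C}_{m,n}$ such that $XAD=D$, $EAX=E$, $\mathcal{R}(X)\subseteq\mathcal{R}(D)$ and $\mathcal{N}(E)\subseteq\mathcal{N}(X)$. Such an $X$ is unique if it exists; it is called the $(D,E)$-inverse of $A$ and denoted $A^{\parallel (D,E)}$. *)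

(* Defs.v *)
From mathcomp Require Import all_boot all_order all_algebra.
From mathcomp Require Import boolp classical_sets reals.
From mathcomp Require Export complex.

Set Implicit Arguments.
Unset Strict Implicit.
Unset Printing Implicit Defensive.

Import Order.TTheory GRing.Theory Num.Theory.

Local Open Scope classical_set_scope.
Local Open Scope ring_scope.
Local Open Scope sesquilinear_scope.

Definition colspace (F : fieldType) p q (M : 'M[F]_(p, q)) : set 'cV[F]_p :=
  range (fun x : 'cV[F]_q => M *m x).

Definition nullspace (F : fieldType) p q (M : 'M[F]_(p, q)) : set 'cV[F]_q :=
  [set x | M *m x = 0].

Definition is_DE_inverse (F : fieldType) m n (A : 'M[F]_(n, m))
    (D E : 'M[F]_(m, n)) (X : 'M[F]_(m, n)) : Prop :=
  [/\ X *m A *m D = D, E *m A *m X = E,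
      colspace X `<=` colspace D & nullspace E `<=` nullspace X].

Definition DE_invertible (F : fieldType) m n (A : 'M[F]_(n, m))
    (D E : 'M[F]_(m, n)) : Prop :=
  exists X : 'M[F]_(m, n), is_DE_inverse A D E X.

(* The value is meaningful only when A is (D, E)-invertible (0 otherwise). *)
Definition DE_inverse (F : fieldType) m n (A : 'M[F]_(n, m))
    (D E : 'M[F]_(m, n)) : 'M[F]_(m, n) :=
  xget 0 [set X | is_DE_inverse A D E X].

(* The four Penrose equations; ^t* is the conjugate transpose. *)
Definition is_moore_penrose (C : numClosedFieldType) p q
    (M : 'M[C]_(p, q)) (X : 'M[C]_(q, p)) : Prop :=
  [/\ M *m X *m M = M, X *m M *m X = X,
      (M *m X) ^t* = M *m X & (X *m M) ^t* = X *m M].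

(* The default 0 is never used, by [moore_penroseP] below. *)
Definition moore_penrose (C : numClosedFieldType) p q (M : 'M[C]_(p, q)) :
    'M[C]_(q, p) :=
  xget 0 [set X | is_moore_penrose M X].

Lemma colspace_mul (F : fieldType) p q r (M : 'M[F]_(p, q)) (N : 'M[F]_(p, r)) :
  colspace M `<=` colspace N -> exists Z, M = N *m Z.
Proof.
move=> sMN; suff /submxP[Z MZ] : (M^T <= N^T)%MS.
  by exists Z^T; rewrite -[LHS]trmxK MZ trmx_mul trmxK.
apply/row_subP => i; rewrite -tr_col colE.
have [|y _ <-] := sMN (M *m delta_mx i 0); first by exists (delta_mx i 0).
by rewrite trmx_mul submxMl.
Qed.

Lemma nullspace_mul (F : fieldType) p p' q r (M : 'M[F]_(p, q))
    (N : 'M[F]_(p', q)) (Z : 'M[F]_(q, r)) :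
  nullspace M `<=` nullspace N -> M *m Z = 0 -> N *m Z = 0.
Proof.
move=> sMN MZ0; apply/trmx_inj/row_matrixP => i.
rewrite trmx0 row0 -tr_col colE -mulmxA sMN ?trmx0//.
by rewrite /nullspace/= mulmxA MZ0 mul0mx.
Qed.

Lemma is_DE_inverse_uniq (F : fieldType) m n (A : 'M[F]_(n, m))
    (D E X Y : 'M[F]_(m, n)) :
  is_DE_inverse A D E X -> is_DE_inverse A D E Y -> X = Y.
Proof.
move=> [XAD _ _ sX] [_ EAY sY _].
have [Z YZ] := colspace_mul sY.
have : X *m (A *m Y - 1%:M) = 0.
  by apply: nullspace_mul sX _; rewrite mulmxBr mulmx1 mulmxA EAY subrr.
by rewrite mulmxBr mulmx1 YZ !mulmxA XAD => /subr0_eq->.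
Qed.

Lemma DE_inverseP (F : fieldType) m n (A : 'M[F]_(n, m)) (D E : 'M[F]_(m, n)) :
  DE_invertible A D E -> is_DE_inverse A D E (DE_inverse A D E).
Proof. exact: xgetPex. Qed.

Section MoorePenrose.
Variable C : numClosedFieldType.

Let ctM p q r (M : 'M[C]_(p, q)) (N : 'M[C]_(q, r)) :
  (M *m N) ^t* = N ^t* *m M ^t*.
Proof. by rewrite trmx_mul map_mxM. Qed.

Lemma is_moore_penrose_uniq p q (M : 'M[C]_(p, q)) (X Y : 'M[C]_(q, p)) :
  is_moore_penrose M X -> is_moore_penrose M Y -> X = Y.
Proof.
move=> [MXM XMX hMX hXM] [MYM YMY hMY hYM].
have eMXY : M *m X = M *m Y.
  by rewrite -hMX -[in LHS]MYM -(mulmxA (M *m Y)) ctM hMX hMY mulmxA MXM.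
have eXYM : X *m M = Y *m M.
  have XYM : X *m M = X *m M *m (Y *m M) by rewrite -[in LHS]MYM !mulmxA.
  by rewrite -hXM XYM ctM hXM hYM -mulmxA (mulmxA M) MXM.
by rewrite -XMX eXYM -mulmxA eMXY mulmxA YMY.
Qed.

Lemma gram_unit p q (B : 'M[C]_(p, q)) : row_free B -> B *m B ^t* \in unitmx.
Proof.
move=> freeB; rewrite -row_free_unit -kermx_eq0.
apply/eqP/row_matrixP => i; rewrite row0.
set v := row i _.
have vG : v *m (B *m B ^t*) = 0 by rewrite -row_mul mulmx_ker row0.
have vB : v *m B = 0.
  have vBvB : dotmx (v *m B) (v *m B) = 0.
    by rewrite dotmxE ctM mulmxA -(mulmxA v) vG mul0mx mxE.
  by apply/eqP; rewrite -(dnorm_eq0 (@dotmx C q)); apply/eqP.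
by apply: (row_free_inj freeB); rewrite vB mul0mx.
Qed.

Lemma is_moore_penrose_exists p q (M : 'M[C]_(p, q)) :
  exists X, is_moore_penrose M X.
Proof.
have [r [B [R [MBR fullB freeR]]]] : exists r (B : 'M[C]_(p, r)) (R : 'M_(r, q)),
    [/\ M = B *m R, row_full B & row_free R].
  exists (\rank M), (col_base M), (row_base M).
  by rewrite mulmx_base col_base_full row_base_free.
have uR : R *m R ^t* \in unitmx by exact: gram_unit.
have uB : B ^t* *m B \in unitmx.
  rewrite -[X in _ *m X]trmxCK; apply: gram_unit.
  by rewrite /row_free mxrank_map mxrank_tr.
pose G := invmx (R *m R ^t*); pose H := invmx (B ^t* *m B).
have hG : G ^t* = G.
  by rewrite /G trmx_inv map_invmx ctM trmxCK.
have hH : H ^t* = H.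
  by rewrite /H trmx_inv map_invmx ctM trmxCK.
pose X := R ^t* *m G *m H *m B ^t*.
have MX : M *m X = B *m H *m B ^t*.
  by rewrite MBR /X !mulmxA -(mulmxA B R) -(mulmxA B _ G) mulmxV// mulmx1.
have XM : X *m M = R ^t* *m G *m R.
  by rewrite MBR /X !mulmxA -(mulmxA _ _ B) -(mulmxA _ H) mulVmx// mulmx1.
exists X; split.
- by rewrite MX MBR mulmxA -(mulmxA _ _ B) -(mulmxA B H) mulVmx// mulmx1.
- by rewrite XM /X !mulmxA -(mulmxA _ R) -(mulmxA _ (R *m _) G) mulmxV// mulmx1.
- by rewrite MX !ctM trmxCK hH mulmxA.
- by rewrite XM !ctM trmxCK hG mulmxA.
Qed.

Lemma moore_penroseP p q (M : 'M[C]_(p, q)) :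
  is_moore_penrose M (moore_penrose M).
Proof. exact: (xgetPex 0 (is_moore_penrose_exists M)). Qed.

End MoorePenrose.

(* Main.v *)
Require Import Defs.
From mathcomp Require Import all_boot all_order all_algebra.
From mathcomp Require Import classical_sets reals complex.

Local Open Scope ring_scope.
Local Open Scope complex_scope.

(** Put M = E A D.  If X is a (D, E)-inverse of A, the inclusions of column
    and null spaces say that X = D Z = W E, so the equations X A D = D and
    E A X = E become D = W M and E = M Z.  Thus D and E factor through M, and
    since M factors through both of them, the three ranks agree.

    Conversely, M lies in the row space of D and in the column space of E, so
    equality of the ranks forces equality of these spaces
    ([mxrank_mul_eqr], [mxrank_mul_eql]): D = W M and E = M Z.  For every G
    with M G M = M, the matrix X = D G E then satisfies
    X A D = W (M G M) = D and E A X = (M G M) Z = E, and its column and null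
    spaces are the right ones by its very form
    ([is_DE_inverse_inner_inverse]).  The Moore-Penrose inverse is such a G,
    and the (D, E)-inverse is unique, which gives the formula. *)

Lemma nullspace_factor {F : fieldType} {p p' q} {M : 'M[F]_(p, q)}
    {N : 'M[F]_(p', q)} :
  (nullspace M `<=` nullspace N)%classic -> exists W, N = W *m M.
Proof.
move=> sMN; apply/submxP; rewrite submxE; apply/eqP.
exact: (nullspace_mul sMN (mulmx_coker M)).
Qed.

(** The row space of [B *m M] is contained in that of [M], so equal dimensions
    make them coincide. *)
Lemma mxrank_mul_eqr {F : fieldType} {p q r} {B : 'M[F]_(p, q)}
    {M : 'M[F]_(q, r)} :
  \rank (B *m M) = \rank M -> exists W, M = W *m (B *m M).
Proof.
move=> eqr; apply/submxP.
by rewrite -(mxrank_leqif_sup (submxMl B M)) eqr.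
Qed.

Lemma mxrank_mul_eql {F : fieldType} {p q r} {M : 'M[F]_(p, q)}
    {B : 'M[F]_(q, r)} :
  \rank (M *m B) = \rank M -> exists Z, M = M *m B *m Z.
Proof.
move=> eqr; have [|W MW] := mxrank_mul_eqr (B := B^T) (M := M^T).
  by rewrite -trmx_mul !mxrank_tr.
by exists W^T; rewrite -[LHS]trmxK MW !trmx_mul !trmxK.
Qed.

Lemma DE_invertible_rank {F : fieldType} {m n} {A : 'M[F]_(n, m)}
    {D E : 'M[F]_(m, n)} :
  DE_invertible A D E ->
  \rank D = \rank E /\ \rank E = \rank (E *m A *m D).
Proof.
case=> X [XAD EAX sXD sEX].
have [Z XZ] := colspace_mul sXD; have [W XW] := nullspace_factor sEX.
have eqD : \rank D = \rank (E *m A *m D).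
  apply/eqP; rewrite eqn_leq mxrankM_maxr andbT.
  by rewrite -[in leqLHS]XAD XW -!mulmxA mxrankM_maxr.
have eqE : \rank E = \rank (E *m A *m D).
  apply/eqP; rewrite eqn_leq -mulmxA mxrankM_maxl andbT.
  by rewrite -[in leqLHS]EAX XZ !mulmxA mxrankM_maxl.
by rewrite eqD eqE.
Qed.

(** With D = W M and E = M Z, the products X A D and E A X both contain the
    block M G M, which the inner inverse [G] collapses to M. *)
Lemma is_DE_inverse_inner_inverse {F : fieldType} {m n} {A : 'M[F]_(n, m)}
    {D E : 'M[F]_(m, n)} {G : 'M[F]_(n, m)} :
  \rank D = \rank E -> \rank E = \rank (E *m A *m D) ->
  E *m A *m D *m G *m (E *m A *m D) = E *m A *m D ->
  is_DE_inverse A D E (D *m G *m E).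
Proof.
move=> eqDE eqE MGM.
have [W DW] : exists W, D = W *m (E *m A *m D).
  by apply: mxrank_mul_eqr; rewrite -eqE eqDE.
have [Z EZ] : exists Z, E = E *m A *m D *m Z.
  have [|Z EZ] := mxrank_mul_eql (M := E) (B := A *m D).
    by rewrite mulmxA -eqE.
  by exists Z; rewrite -(mulmxA E).
split.
- rewrite -!mulmxA [in LHS](mulmxA E) [X in X *m _]DW.
  by rewrite -!(mulmxA W) (mulmxA _ G) MGM -DW.
- rewrite !mulmxA [X in _ *m X]EZ !mulmxA.
  by rewrite -(mulmxA _ E) -(mulmxA _ _ D) MGM -EZ.
- by move=> _ [x _ <-]; exists (G *m E *m x); rewrite // !mulmxA.
- by move=> x /= Ex0; rewrite /nullspace /= -mulmxA Ex0 mulmx0.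
Qed.

Theorem theorem4p4 (R : realType) (m n : nat)
    (A : 'M[R[i]]_(n, m)) (D E : 'M[R[i]]_(m, n)) :
  (DE_invertible A D E <->
     (\rank D = \rank E /\ \rank E = \rank (E *m A *m D))) /\
  (DE_invertible A D E ->
     DE_inverse A D E = D *m moore_penrose (E *m A *m D) *m E).
Proof.
have rank_inv : \rank D = \rank E /\ \rank E = \rank (E *m A *m D) ->
    is_DE_inverse A D E (D *m moore_penrose (E *m A *m D) *m E).
  case=> eqDE eqE; apply: is_DE_inverse_inner_inverse => //.
  by have [] := moore_penroseP (E *m A *m D).
split; first split.
- exact: DE_invertible_rank.
- by move=> /rank_inv invX; exists (D *m moore_penrose (E *m A *m D) *m E).
- move=> invA; apply: is_DE_inverse_uniq (DE_inverseP invA) _.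
  exact/rank_inv/DE_invertible_rank.
Qed.
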